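(* If $A$ is an elementary abelian $p^n$-group of ppc-rank $r$, then there are exactly $\frac{1}{6}(r+1)(r+2)(r+3)$ isomorphism classes of associative interchange rings with additive group $(A,+)$.
   Context: For a prime $p$ and integers $n,r\ge1$, an elementary abelian $p^n$-group of ppc-rank $r$ is a direct sum of $r$ copies of the cyclic group of order $p^n$. An interchange ring is a triple $(A,+,\bullet)$ where $(A,+)$ is an abelian group and $\bullet$ is a binary operation satisfying $(w+x)\bullet(y+z) = (w\bullet y)+(x\bullet z)$ for all $w,x,y,z\in A$; it is associative if $(A,\bullet)$ is associative. An isomorphism of interchange rings is a bijection that is a homomorphism for both operations. *)

(* Defs.v *)
From HB Require Import structures.
From mathcomp Require Import all_boot all_order all_algebra all_fingroup.
Set Implicit Arguments. Unset Strict Implicit. Unset Printing Implicit Defensive.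
Import GRing.Theory.
Local Open Scope ring_scope.

Definition binop (A : finZmodType) := {ffun A * A -> A}.

Definition bmul (A : finZmodType) (m : binop A) (x y : A) : A := m (x, y).

Definition is_interchange (A : finZmodType) (m : binop A) : bool :=
  [forall w : A, forall x : A, forall y : A, forall z : A,
     bmul m (w + x) (y + z) == bmul m w y + bmul m x z].

Definition is_assoc (A : finZmodType) (m : binop A) : bool :=
  [forall x : A, forall y : A, forall z : A,
     bmul m x (bmul m y z) == bmul m (bmul m x y) z].

Definition assoc_interchange_rings (A : finZmodType) : {set binop A} :=
  [set m : binop A | is_interchange m && is_assoc m].

Definition ir_iso (A : finZmodType) (m m' : binop A) : bool :=
  [exists f : {perm A},
     [forall x : A, forall y : A, f (x + y) == f x + f y] &&
     [forall x : A, forall y : A, f (bmul m x y) == bmul m' (f x) (f y)]].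

Definition iso_classes (A : finZmodType) : {set {set binop A}} :=
  [set [set m' in assoc_interchange_rings A | ir_iso m m'] | m in assoc_interchange_rings A].

Definition elem_ab (p n r : nat) : finZmodType := 'rV['Z_(p ^ n)]_r.

(* Main.v *)
(* An interchange operation is a homomorphism A x A -> A, so it has the form
   x . y = x a + y b with endomorphisms a, b of A, i.e. matrices over Z/p^n;
   associativity says exactly that a and b are commuting idempotents.  The
   products of a or 1 - a with b or 1 - b are then four orthogonal idempotents
   with sum 1.  Over the residue field F_p such systems are conjugate as soon as
   their ranks agree, and a conjugation lifts to the local ring Z/p^n.  Hence
   isomorphism classes correspond to the compositions of r into four ranks, and
   there are 'C(r + 3, 3) of these. *)
From HB Require Import structures.
Require Import Defs.
From mathcomp Require Import all_boot all_order all_algebra all_fingroup.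
Set Implicit Arguments. Unset Strict Implicit. Unset Printing Implicit Defensive.
Import GRing.Theory.

(** * Peirce components of a pair of commuting idempotent matrices *)

Section PeirceComponents.
Local Open Scope ring_scope.
Variables (R : pzRingType) (r : nat).
Implicit Types (a b u : 'M[R]_r) (s t : bool * bool).

Definition comm_idem a b := [/\ a *m a = a, b *m b = b & a *m b = b *m a].

Definition side (c : bool) a := if c then a else 1%:M - a.

Definition peirce a b s := side s.1 a *m side s.2 b.

Lemma side_mul c d a : a *m a = a ->
  side c a *m side d a = if c == d then side c a else 0.
Proof.
by case: c d => [] [] aa; rewrite /= ?(mulmxBl, mulmxBr, mul1mx, mulmx1) ?aa
  ?subrr ?subr0.
Qed.

Lemma side_conj c a a' u : a *m u = u *m a' -> side c a *m u = u *m side c a'.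
Proof. by case: c => //= au; rewrite mulmxBl mulmxBr mul1mx mulmx1 au. Qed.

Lemma peirce_mul a b s t : comm_idem a b ->
  peirce a b s *m peirce a b t = if s == t then peirce a b s else 0.
Proof.
case: s t => [c d] [c' d'] [aa bb ab]; rewrite /peirce /= xpair_eqE.
(* Intertwining [a] with itself is commutation, so [side_conj], used once on each factor, carries
   [ab] over to complements. *)
have comm : side d b *m side c' a = side c' a *m side d b.
  by apply: side_conj; apply/esym/side_conj.
rewrite mulmxA -(mulmxA (side c a)) comm mulmxA -mulmxA !side_mul //.
by case: (c == c'); case: (d == d'); rewrite ?mul0mx ?mulmx0.
Qed.

Lemma peirce_sum_fst a b : \sum_(s | s.1) peirce a b s = a.
Proof.
rewrite (eq_bigl (fun s => s.1 && true)) => [|s]; last by rewrite andbT.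
rewrite -(pair_big_dep id (fun _ _ => true) (fun c d => peirce a b (c, d))) /=.
by rewrite big_mkcond !big_bool /= addr0 /peirce /= -mulmxDr subrKC mulmx1.
Qed.

Lemma peirce_sum_snd a b : \sum_(s | s.2) peirce a b s = b.
Proof.
rewrite (eq_bigl (fun s => true && s.2)) => [|s //].
rewrite -(pair_big_dep predT (fun _ => id) (fun c d => peirce a b (c, d))) /=.
rewrite big_bool /= !(big_mkcond id) !big_bool /= !addr0 /peirce /=.
by rewrite -mulmxDl subrKC mul1mx.
Qed.

Lemma peirce_sum a b : \sum_s peirce a b s = 1%:M.
Proof.
rewrite -(pair_bigA _ (fun c d => peirce a b (c, d))) /= !big_bool /= /peirce /=.
by rewrite -!mulmxDr -mulmxDl !subrKC mulmx1.
Qed.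

Lemma peirce_conj a b a' b' u s : a *m u = u *m a' -> b *m u = u *m b' ->
  peirce a b s *m u = u *m peirce a' b' s.
Proof.
by move=> au bu; rewrite -mulmxA (side_conj _ bu) mulmxA (side_conj _ au) -mulmxA.
Qed.

(** Converse of [peirce_conj]: [a] and [b] are sums of their own Peirce components, so intertwining
    the components suffices. *)
Lemma conj_peirce a b a' b' u :
    (forall s, peirce a b s *m u = u *m peirce a' b' s) ->
  a *m u = u *m a' /\ b *m u = u *m b'.
Proof.
move=> eu; split.
  rewrite -{1}(peirce_sum_fst a b) -{1}(peirce_sum_fst a' b').
  by rewrite mulmx_suml mulmx_sumr; apply: eq_bigr => s _; apply: eu.
rewrite -{1}(peirce_sum_snd a b) -{1}(peirce_sum_snd a' b').
by rewrite mulmx_suml mulmx_sumr; apply: eq_bigr => s _; apply: eu.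
Qed.

(** Pairs of these diagonal idempotents serve as representatives realising every rank vector. *)
Definition mask_mx (P : pred 'I_r) : 'M[R]_r := diag_mx (\row_i (P i)%:R).

Lemma mask_mxM P Q : mask_mx P *m mask_mx Q = mask_mx (predI P Q).
Proof.
rewrite mulmx_diag; congr diag_mx; apply/rowP=> i; rewrite !mxE /=.
by case: (P i); rewrite ?mul1r ?mul0r.
Qed.

Lemma side_mask c P : side c (mask_mx P) = mask_mx (fun i => P i == c).
Proof.
apply/matrixP=> i j; rewrite /side /mask_mx; case: c; rewrite !mxE.
  by rewrite eqb_id.
by case: eqP => _; rewrite ?subr0 //; case: (P i); rewrite ?subrr ?subr0.
Qed.

Lemma mask_mx_comm_idem P Q : comm_idem (mask_mx P) (mask_mx Q).
Proof.
by split; rewrite !mask_mxM; congr diag_mx; apply/rowP=> i; rewrite !mxE /=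
  ?andbb // andbC.
Qed.

End PeirceComponents.

Lemma map_peirce (R S : pzRingType) (phi : {rmorphism R -> S}) r
    (a b : 'M[R]_r) s :
  map_mx phi (peirce a b s) = peirce (map_mx phi a) (map_mx phi b) s.
Proof.
rewrite /peirce map_mxM; congr (_ *m _)%R.
  by case: s.1; rewrite //= map_mxB map_mx1.
by case: s.2; rewrite //= map_mxB map_mx1.
Qed.

Lemma map_comm_idem (R S : pzRingType) (phi : {rmorphism R -> S}) r
    (a b : 'M[R]_r) : comm_idem a b -> comm_idem (map_mx phi a) (map_mx phi b).
Proof. by case=> aa bb ab; split; rewrite -!map_mxM ?aa ?bb ?ab. Qed.

Lemma map_mask_mx (R S : pzRingType) (phi : {rmorphism R -> S}) r
    (P : pred 'I_r) :
  map_mx phi (mask_mx R P) = mask_mx S P.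
Proof.
by rewrite map_diag_mx; congr diag_mx; apply/rowP=> i; rewrite !mxE rmorph_nat.
Qed.

(** * Idempotent matrices over a field: ranks and simultaneous conjugation *)

Section Field.
Local Open Scope ring_scope.
Variables (F : fieldType) (r : nat).
Implicit Types (a b e f : 'M[F]_r).

(** In a full-rank factorization [e = C *m D], idempotence reads [C *m (D *m C) *m D = C *m D], and
    [C], [D] cancel. The separate variable [k] lets two idempotents of equal rank factor through the
    same matrix type. *)
Lemma idem_factor e k : e *m e = e -> \rank e = k ->
  exists C : 'M_(r, k), exists D : 'M_(k, r), C *m D = e /\ D *m C = 1%:M.
Proof.
move=> ee <-; exists (col_base e), (row_base e); split; first exact: mulmx_base.
apply: (row_free_inj (row_base_free e)).
apply: (row_full_inj (col_base_full e)).
by rewrite /= mul1mx mulmx_base -(mulmxA (row_base e)) mulmxA mulmx_base ee.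
Qed.

(** Rank-nullity for [a] acting on the row space of [b]: the kernel there is the row space of
    [b *m (1%:M - a)], because a vector killed by [a] is fixed by [1%:M - a]. *)
Lemma mxrank_split_idem a b : a *m a = a -> a *m b = b *m a ->
  (\rank (b *m a) + \rank (b *m (1%:M - a)))%N = \rank b.
Proof.
move=> aa ab; rewrite -[RHS](mxrank_mul_ker b a); congr addn.
apply/eqmx_rank/andP; split.
  rewrite sub_capmx; apply/andP; split; last first.
    by apply/sub_kermxP; rewrite -mulmxA mulmxBl mul1mx aa subrr mulmx0.
  by rewrite mulmxBr mulmx1 -ab -{1}[b]mul1mx -mulmxBl submxMl.
have /sub_kermxP xa : (b :&: kermx a <= kermx a)%MS by apply: capmxSr.
have /submxP[D xD] := capmxSl b (kermx a).
have <- : (b :&: kermx a)%MS *m (1%:M - a) = (b :&: kermx a)%MS.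
  by rewrite mulmxBr mulmx1 xa subr0.
by rewrite {1}xD -mulmxA submxMl.
Qed.

Lemma mxrank_mask (P : pred 'I_r) : \rank (mask_mx F P) = #|P|.
Proof.
(* The rows of [C] are the standard basis vectors indexed by [P], so the mask is [C^T *m C] with [C]
   of full row rank. *)
pose C : 'M[F]_(#|P|, r) := \matrix_(i, j) (j == enum_val i)%:R.
have CC : C *m C^T = 1%:M.
  apply/matrixP=> i j; rewrite !mxE (bigD1 (enum_val i)) //= !mxE eqxx mul1r.
  rewrite big1 ?addr0 => [|k /negPf ki]; last by rewrite !mxE ki mul0r.
  by rewrite (inj_eq enum_val_inj).
have freeC : row_free C by apply/row_freeP; exists C^T.
have -> : mask_mx F P = C^T *m C.
  apply/matrixP=> i j; rewrite !mxE; case Pi: (P i); last first.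
    rewrite mul0rn big1 // => k _; rewrite !mxE; case: eqP => [ik|]; rewrite ?mul0r //.
    by have := enum_valP k; rewrite -ik unfold_in Pi.
  rewrite (bigD1 (enum_rank_in Pi i)) //= !mxE enum_rankK_in // eqxx mul1r.
  rewrite eq_sym big1 ?addr0 // => k ki; rewrite !mxE.
  case: eqP => [ik|]; rewrite ?mul0r //.
  by case/eqP: ki; apply: enum_val_inj; rewrite enum_rankK_in.
by rewrite mxrankMfree // mxrank_tr; apply/eqP.
Qed.

(** Equal ranks give mutually inverse maps between the images of [e i] and [f i]; their sum over [i]
    is the conjugating matrix. *)
Lemma orthogonal_idem_conj (I : finType) (e f : I -> 'M[F]_r) :
    (forall i j, e i *m e j = if i == j then e i else 0) ->
    (forall i j, f i *m f j = if i == j then f i else 0) ->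
    \sum_i e i = 1%:M -> (forall i, \rank (e i) = \rank (f i)) ->
  exists2 u : 'M[F]_r, u \in unitmx & forall i, e i *m u = u *m f i.
Proof.
move=> ee ff e1 rk.
have /fin_all_exists[gh ghP] i : exists gh : 'M[F]_r * 'M[F]_r,
    [/\ gh.1 *m gh.2 = e i, e i *m gh.1 = gh.1,
        gh.1 *m f i = gh.1 & f i *m gh.2 = gh.2].
  have [k rke] : exists k, \rank (e i) = k by exists (\rank (e i)).
  have rkf : \rank (f i) = k by rewrite -rk.
  have [|C [D [CD DC]]] := idem_factor _ rke; first by rewrite ee eqxx.
  have [|C' [D' [CD' DC']]] := idem_factor _ rkf; first by rewrite ff eqxx.
  (* Both idempotents factor through dimension [k]; crossing the factors gives a map and its inverse
     between the two images. *)
  exists (C *m D', C' *m D); split=> /=.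
  - by rewrite mulmxA -(mulmxA C) DC' mulmx1.
  - by rewrite -CD mulmxA -(mulmxA C) DC mulmx1.
  - by rewrite -CD' mulmxA -(mulmxA C) DC' mulmx1.
  - by rewrite -CD' mulmxA -(mulmxA C') DC' mulmx1.
exists (\sum_i (gh i).1) => [|i].
  (* The inverse is the sum of the second components: cross terms vanish by orthogonality of the
     [f i], and diagonal terms add up to [\sum_i e i]. *)
  have [] // := @mulmx1_unit _ _ (\sum_i (gh i).1) (\sum_i (gh i).2).
  rewrite -e1 mulmx_suml; apply: eq_bigr => i _; have [<- _ gf _] := ghP i.
  rewrite mulmx_sumr (bigD1 i) //= big1 ?addr0 // => j /negPf ji.
  have [_ _ _ <-] := ghP j.
  by rewrite -gf mulmxA -(mulmxA _ (f i)) ff eq_sym ji mulmx0 mul0mx.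
rewrite mulmx_sumr mulmx_suml; apply: eq_bigr => j _.
have [_ eg gf _] := ghP j.
have [->|/negPf ij] := eqVneq i j; first by rewrite eg gf.
have -> : e i *m (gh j).1 = 0 by rewrite -eg mulmxA ee ij mul0mx.
by rewrite -gf -mulmxA ff eq_sym ij mulmx0.
Qed.

End Field.

(** * Lifting from the residue field [F] of a local ring [R]; [psi] is only a set-theoretic section
    of [phi] *)

Section LocalRing.
Local Open Scope ring_scope.
Variables (R : comUnitRingType) (F : fieldType) (phi : {rmorphism R -> F}).
Variables (psi : F -> R) (r : nat).
Hypothesis psiK : cancel psi phi.
Hypothesis phi_unit : forall x, phi x != 0 -> x \is a GRing.unit.

Lemma unitmx_residue (u : 'M[R]_r) : map_mx phi u \in unitmx -> u \in unitmx.
Proof.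
by rewrite !unitmxE det_map_mx unitfE; apply: phi_unit.
Qed.

(* If w conjugates the residues of e to those of f, then \sum_i e i w f i
   intertwines e and f and has the same residue as w, so it is invertible. *)
Lemma orthogonal_idem_conj_lift (I : finType) (e f : I -> 'M[R]_r) :
    (forall i j, e i *m e j = if i == j then e i else 0) ->
    (forall i j, f i *m f j = if i == j then f i else 0) ->
    \sum_i e i = 1%:M ->
    (forall i, \rank (map_mx phi (e i)) = \rank (map_mx phi (f i))) ->
  exists2 u : 'M[R]_r, u \in unitmx & forall i, e i *m u = u *m f i.
Proof.
move=> ee ff e1 rk.
have [|||w wU ew] := @orthogonal_idem_conj _ _ _ (fun i => map_mx phi (e i))
  (fun i => map_mx phi (f i)) _ _ _ rk.
- by move=> i j; rewrite -map_mxM ee; case: eqP; rewrite // map_mx0.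
- by move=> i j; rewrite -map_mxM ff; case: eqP; rewrite // map_mx0.
- by rewrite -(map_mx1 phi) -e1 raddf_sum.
exists (\sum_i e i *m map_mx psi w *m f i) => [|i].
  apply: unitmx_residue; rewrite raddf_sum /=.
  suff -> : \sum_i map_mx phi (e i *m map_mx psi w *m f i) = w by [].
  rewrite -[RHS]mul1mx -(map_mx1 phi) -e1 raddf_sum mulmx_suml /=.
  apply: eq_bigr => i _; rewrite !map_mxM -map_mx_comp map_mx_id.
    by rewrite -mulmxA -ew mulmxA -map_mxM ee eqxx.
  by move=> x /=; rewrite psiK.
rewrite mulmx_sumr mulmx_suml; apply: eq_bigr => j _.
by rewrite !mulmxA ee -!mulmxA ff eq_sym; case: eqP => [->|_];
  rewrite ?mul0mx ?mulmx0.
Qed.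

(** The rank of an idempotent over the local ring is read off over its residue field. *)
Definition peirce_rank (a b : 'M[R]_r) s : nat :=
  \rank (map_mx phi (peirce a b s)).

Lemma peirce_rank_lt (a b : 'M[R]_r) s : (peirce_rank a b s < r.+1)%N.
Proof. exact: rank_leq_row. Qed.

Lemma peirce_rank_conjP (a b a' b' : 'M[R]_r) :
    comm_idem a b -> comm_idem a' b' ->
  (exists u : 'M[R]_r, [/\ u \in unitmx, a *m u = u *m a' & b *m u = u *m b'])
    <-> peirce_rank a b =1 peirce_rank a' b'.
Proof.
move=> ab ab'; split=> [[u [uU au bu]] s | rk].
  have uU' : map_mx phi u \in unitmx.
    by move: uU; rewrite !unitmxE det_map_mx; apply: rmorph_unit.
  have/(congr1 (map_mx phi)) := peirce_conj s au bu.
  rewrite [in LHS]map_mxM [in RHS]map_mxM => /(congr1 mxrank).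
  rewrite mxrankMfree ?row_free_unit // => rk.
  by rewrite /peirce_rank rk (eqmxMfull _ _) // row_full_unit.
have [||||u uU eu] := @orthogonal_idem_conj_lift _ (peirce a b) (peirce a' b').
- by move=> s t; apply: peirce_mul.
- by move=> s t; apply: peirce_mul.
- exact: peirce_sum.
- exact: rk.
by have [au bu] := conj_peirce eu; exists u.
Qed.

(** The rank splits twice: [b] splits [a] and [1%:M - a], and [a] splits the identity. *)
Lemma sum_peirce_rank (a b : 'M[R]_r) :
  comm_idem a b -> (\sum_s peirce_rank a b s)%N = r.
Proof.
move=> /(map_comm_idem phi); rewrite /peirce_rank.
set a' := map_mx phi a; set b' := map_mx phi b; case=> aa bb ab.
rewrite (eq_bigr (fun s => \rank (peirce a' b' s))) => [|s _]; last first.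
  by rewrite map_peirce.
rewrite -(pair_bigA _ (fun c d => \rank (peirce a' b' (c, d)))) /=.
rewrite !big_bool /= /peirce /=.
have ab1 : b' *m (1%:M - a') = (1%:M - a') *m b'.
  by apply/esym/(side_conj false).
rewrite !mxrank_split_idem //.
by rewrite -[a']mul1mx mul1mx -[X in \rank X]mul1mx -[X in (_ + \rank X)%N]mul1mx
  mxrank_split_idem ?mxrank1 // mul1mx mulmx1.
Qed.

Lemma peirce_rank_mask (P Q : pred 'I_r) s :
  peirce_rank (mask_mx R P) (mask_mx R Q) s =
  #|[pred i | (P i == s.1) && (Q i == s.2)]|.
Proof.
by rewrite /peirce_rank map_peirce !map_mask_mx /peirce !side_mask mask_mxM
  mxrank_mask.
Qed.

End LocalRing.

(** A nonzero residue means that [p] does not divide the representative, which is then coprime to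
    [p ^ n]. *)
Lemma residue_Zp p n : prime p -> (0 < n)%N ->
  exists (phi : {rmorphism 'Z_(p ^ n) -> 'F_p}) (psi : 'F_p -> 'Z_(p ^ n)),
    cancel psi phi /\ forall x, phi x != 0%R -> x \is a GRing.unit.
Proof.
move=> p_pr n_gt0.
have p_gt1 := prime_gt1 p_pr.
(* The type ['Z_q] is the ring of integers modulo [q] only for [q > 1]. *)
have q_gt1 : (1 < p ^ n)%N by rewrite -(exp1n n) ltn_exp2r.
pose red (x : 'Z_(p ^ n)) : 'F_p := (x : nat)%:R%R.
(* As [p] divides [p ^ n], the value does not depend on the representative; the morphism laws then
   come from those of natural numbers. *)
have red_nat k : red k%:R%R = k%:R%R.
  rewrite /red val_Zp_nat // -Fp_nat_mod // modn_dvdm ?Fp_nat_mod //.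
  exact: dvdn_exp.
have ZpE (x : 'Z_(p ^ n)) : x = (x : nat)%:R%R by rewrite natr_Zp.
have redD : {morph red : x y / (x + y)%R}.
  by move=> x y; rewrite [x]ZpE [y]ZpE -natrD !red_nat natrD.
have redB : zmod_morphism red.
  by move=> x y; apply/esym/eqP; rewrite subr_eq -redD subrK.
have redM : monoid_morphism red.
  split; first by rewrite -[1%R]/(1%:R)%R red_nat.
  by move=> x y; rewrite [x]ZpE [y]ZpE -natrM !red_nat natrM.
pose phi : {rmorphism 'Z_(p ^ n) -> 'F_p} := HB.pack red
  (GRing.isZmodMorphism.Build _ _ red redB)
  (GRing.isMonoidMorphism.Build _ _ red redM).
exists phi, (fun y => (y : nat)%:R%R); split=> [y|x].
  by rewrite /= red_nat natr_Zp.
rewrite /= [x]ZpE red_nat unitZpE // coprime_pexpl // prime_coprime //.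
by rewrite -(dvdn_pcharf (pchar_Fp p_pr)).
Qed.

(** * Associative interchange operations as pairs of commuting idempotent matrices *)

Section InterchangeRings.
Local Open Scope ring_scope.
Variables (q r : nat).
Let A : finZmodType := 'rV['Z_q]_r.
Implicit Types (a b u : 'M['Z_q]_r) (m : binop A).

Definition lin_of (g : 'rV['Z_q]_r -> 'rV['Z_q]_r) : 'M['Z_q]_r :=
  \matrix_i g (delta_mx 0 i).

(* Every element of Z/q is a multiple of 1, so additive maps are linear. *)
Lemma mul_lin_of g : (forall x y, g (x + y) = g x + g y) ->
  forall x, g x = x *m lin_of g.
Proof.
move=> gD x.
have g0 : g 0 = 0 by apply: (addrI (g 0)); rewrite -gD !addr0.
have gZ c y : g (c *: y) = c *: g y.
  rewrite -[c]natr_Zp !scaler_nat; elim: (c : nat) => [|k IHk].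
    by rewrite !mulr0n.
  by rewrite !mulrS gD IHk.
rewrite mulmx_sum_row [in LHS](row_sum_delta x) (big_morph g gD g0).
by apply: eq_bigr => i _; rewrite gZ rowK.
Qed.

Lemma mulmx_inj_l a b : (forall x : 'rV_r, x *m a = x *m b) -> a = b.
Proof. by move=> ab; apply/row_matrixP=> i; rewrite !rowE ab. Qed.

Definition mx_binop a b : binop A :=
  [ffun xy : A * A => (xy.1 : 'rV_r) *m a + (xy.2 : 'rV_r) *m b].

Definition lmx m : 'M['Z_q]_r := lin_of (fun x => bmul m (x : A) (0 : A)).
Definition rmx m : 'M['Z_q]_r := lin_of (fun x => bmul m (0 : A) (x : A)).

Lemma mx_binopE a b (x y : 'rV['Z_q]_r) :
  bmul (mx_binop a b) x y = x *m a + y *m b.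
Proof. by rewrite /bmul ffunE. Qed.

Lemma mx_binopK a b : lmx (mx_binop a b) = a /\ rmx (mx_binop a b) = b.
Proof.
split; apply: mulmx_inj_l => x; rewrite -mul_lin_of => [|y z];
  by rewrite !mx_binopE ?mulmxDl mul0mx ?addr0 ?add0r.
Qed.

Lemma mx_binop_assoc_interchange a b :
  comm_idem a b -> mx_binop a b \in assoc_interchange_rings A.
Proof.
case=> aa bb ab; rewrite inE; apply/andP; split.
  apply/'forall_forallP => w x; apply/'forall_forallP => y z; apply/eqP.
  by rewrite !mx_binopE !mulmxDl addrACA.
apply/'forall_forallP => x y; apply/forallP => z; apply/eqP.
by rewrite !mx_binopE !mulmxDl -!mulmxA aa bb ab addrA.
Qed.

Lemma assoc_interchange_mx m : m \in assoc_interchange_rings A ->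
  m = mx_binop (lmx m) (rmx m) /\ comm_idem (lmx m) (rmx m).
Proof.
rewrite inE => /andP[/'forall_forallP mI /'forall_forallP mA].
have mD w x y z : bmul m (w + x) (y + z) = bmul m w y + bmul m x z.
  by apply/eqP; move/'forall_forallP: (mI w x); apply.
have mE x y : bmul m x y = (x : 'rV_r) *m lmx m + (y : 'rV_r) *m rmx m.
  (* Interchange applied to [(x + 0) . (0 + y)] separates the two arguments. *)
  rewrite -[x in LHS]addr0 -[y in LHS]add0r mD.
  by congr (_ + _); apply: (@mul_lin_of (fun t => _)) => s t;
    rewrite -mD !addr0.
have mAE (x y z : 'rV['Z_q]_r) :
    x *m lmx m + (y *m lmx m + z *m rmx m) *m rmx m
    = (x *m lmx m + y *m rmx m) *m lmx m + z *m rmx m.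
  by rewrite -!mE; apply/eqP; move/forallP: (mA x y); apply.
split.
  by apply/ffunP=> -[x y]; rewrite -[LHS]/(bmul m x y) -[RHS]/(bmul _ x y)
    mx_binopE mE.
(* Associativity at [(x, 0, 0)], [(0, 0, x)] and [(0, x, 0)] gives in turn the two idempotence laws
   and commutation. *)
split; apply: mulmx_inj_l => x.
- by have := mAE x 0 0; rewrite !mul0mx !addr0 mul0mx addr0 mulmxA.
- by have := mAE 0 0 x; rewrite !mul0mx !add0r mul0mx add0r mulmxA.
- by have := mAE 0 x 0; rewrite !mul0mx !addr0 !add0r !mulmxA.
Qed.

(** An additive bijection and its inverse are both given by matrices, so it is an invertible [u];
    setting one argument of the product to zero isolates each intertwining relation. *)
Lemma ir_iso_mxP a b a' b' :
  reflect (exists u, [/\ u \in unitmx, a *m u = u *m a' & b *m u = u *m b'])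
    (ir_iso (mx_binop a b) (mx_binop a' b')).
Proof.
apply: (iffP existsP) => [[f /andP[/'forall_forallP fD /'forall_forallP fM]] | ].
  have {}fD x y : f (x + y) = f x + f y by apply/eqP.
  have {}fM (x y : 'rV['Z_q]_r) :
      f (x *m a + y *m b) = (f x : 'rV_r) *m a' + (f y : 'rV_r) *m b'.
    by rewrite -!mx_binopE; apply/eqP/fM.
  pose g (x : 'rV['Z_q]_r) : 'rV['Z_q]_r := f x.
  pose g' (x : 'rV['Z_q]_r) : 'rV['Z_q]_r := (f^-1)%g x.
  have gE := @mul_lin_of g fD.
  have g'E : forall x, g' x = x *m lin_of g'.
    by apply: mul_lin_of => x y; apply: (@perm_inj _ f); rewrite fD !permKV.
  have g0 : g 0 = 0 by rewrite gE mul0mx.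
  exists (lin_of g); split.
  - have [] // := @mulmx1_unit _ _ (lin_of g) (lin_of g').
    by apply: mulmx_inj_l => x; rewrite mulmxA -gE -g'E mulmx1 /g' permK.
  - apply: mulmx_inj_l => x; rewrite !mulmxA -!gE.
    by have := fM x 0; rewrite mul0mx addr0 -![f _]/(g _) g0 mul0mx addr0.
  - apply: mulmx_inj_l => x; rewrite !mulmxA -!gE.
    by have := fM 0 x; rewrite mul0mx add0r -![f _]/(g _) g0 mul0mx add0r.
case=> u [uU au bu].
have uI : injective (fun x : A => (x : 'rV_r) *m u : A).
  by apply: (can_inj (g := fun x : A => (x : 'rV_r) *m invmx u : A)) => x;
    rewrite mulmxK.
exists (perm uI); apply/andP; split; apply/'forall_forallP => x y; rewrite !permE.
  by rewrite mulmxDl.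
by rewrite !mx_binopE mulmxDl -!mulmxA au bu.
Qed.

End InterchangeRings.

(** * The complete invariant and the count of its values *)

Lemma sum_boolX (f : bool * bool -> nat) :
  \sum_s f s = f (true, true) +
    (f (true, false) + (f (false, true) + f (false, false))).
Proof.
rewrite (eq_bigr (fun s => f (s.1, s.2))) => [|[] //].
by rewrite -(pair_bigA _ (fun c d => f (c, d))) /= !big_bool /= !addnA.
Qed.

(** The bounds matter: [inord] sends every out-of-range number to the default [0]. *)
Lemma inord_inj r k l : k < r.+1 -> l < r.+1 ->
  inord k = inord l :> 'I_r.+1 -> k = l.
Proof. by move=> kr lr /(congr1 (@nat_of_ord _)); rewrite !inordK. Qed.

(** The classes are the fibres of a complete invariant, and a nonempty fibre determines its
    value. *)
Lemma card_class_imset (S T : finType) (D : {set S}) (e : rel S) (inv : S -> T) :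
  {in D &, forall x y, e x y = (inv x == inv y)} ->
  #|[set [set y in D | e x y] | x in D]| = #|inv @: D|.
Proof.
move=> eE; pose fib t := [set y in D | t == inv y].
have -> : [set [set y in D | e x y] | x in D] = fib @: (inv @: D).
  rewrite -imset_comp; apply: eq_in_imset => x xD; apply/setP=> y.
  by rewrite !inE; case: (boolP (y \in D)) => // yD; rewrite eE.
apply: card_in_imset => _ _ /imsetP[x xD ->] /imsetP[y yD ->] /setP/(_ x).
by rewrite !inE xD eqxx => /esym/eqP.
Qed.

Section Classification.
Variables (p n r : nat).
Variables (phi : {rmorphism 'Z_(p ^ n) -> 'F_p}) (psi : 'F_p -> 'Z_(p ^ n)).
Hypothesis psiK : cancel psi phi.
Hypothesis phi_unit : forall x, phi x != 0%R -> x \is a GRing.unit.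

(** The four ranks are bundled as bounded ordinals to match [card_ord_partitions]; [inord] loses
    nothing since every rank is at most [r]. *)
Definition peirce_type (m : binop (elem_ab p n r)) : 4.-tuple 'I_r.+1 :=
  [tuple of [seq inord (peirce_rank phi (lmx m) (rmx m) s)
    | s <- [:: (true, true); (true, false); (false, true); (false, false)]]].

Lemma peirce_type_imset :
  peirce_type @: assoc_interchange_rings (elem_ab p n r)
  = [set t : 4.-tuple 'I_r.+1 | \sum_(i <- t) i == r].
Proof.
apply/setP=> t; rewrite inE; apply/imsetP/eqP=> [[m mS ->] | tr].
  have [_ ab] := assoc_interchange_mx mS.
  have rE s : (inord (peirce_rank phi (lmx m) (rmx m) s) : 'I_r.+1)
      = peirce_rank phi (lmx m) (rmx m) s :> nat.
    by rewrite inordK // peirce_rank_lt.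
  rewrite big_map -[RHS](sum_peirce_rank phi ab) sum_boolX.
  by rewrite (eq_bigr _ (fun s _ => rE s)) !big_cons big_nil addn0.
case: t tr => [[|t0 [|t1 [|t2 [|t3 [|? ?]]]]] sz] //.
rewrite /= !big_cons big_nil addn0 => tr.
(* Each of the [r] coordinates is assigned one of the four types, with the prescribed
   multiplicities; the diagonal idempotents [a] and [b] record its two bits, so ranks become
   multiplicities in [w]. *)
pose w : seq (bool * bool) :=
  nseq t0 (true, true) ++ nseq t1 (true, false)
  ++ nseq t2 (false, true) ++ nseq t3 (false, false).
have sw : size w == r.
  by rewrite !size_cat !size_nseq tr.
pose W := Tuple sw.
pose a := mask_mx 'Z_(p ^ n) (fun i : 'I_r => (tnth W i).1).
pose b := mask_mx 'Z_(p ^ n) (fun i : 'I_r => (tnth W i).2).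
exists (mx_binop a b).
  by apply: mx_binop_assoc_interchange; apply: mask_mx_comm_idem.
have rE s : peirce_rank phi a b s = count_mem s w.
  rewrite peirce_rank_mask.
  rewrite -[w]/(tval W) -[X in count _ X](map_tnth_enum W) count_map.
  rewrite -sum1_count big_enum_cond -sum1_card; apply: eq_bigl => i.
  by rewrite /= !inE -xpair_eqE; case: (tnth W i) s => ? ? [].
rewrite /peirce_type; have [-> ->] := mx_binopK a b.
apply: val_inj => /=; rewrite !rE !count_cat !count_nseq /=.
by rewrite !mul1n !mul0n !addn0 !add0n !inord_val.
Qed.

Lemma ir_iso_peirce_type :
  {in assoc_interchange_rings (elem_ab p n r) &,
    forall m m', ir_iso m m' = (peirce_type m == peirce_type m')}.
Proof.
move=> m m' mS m'S.
have [mE ab] := assoc_interchange_mx mS.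
have [mE' ab'] := assoc_interchange_mx m'S.
have [rkI rkC] := peirce_rank_conjP psiK phi_unit ab ab'.
have isoP := ir_iso_mxP (lmx m) (rmx m) (lmx m') (rmx m').
rewrite -mE -mE' in isoP.
apply/isoP/eqP=> [/rkI rk | tt].
  by apply: val_inj; apply: eq_map => s; rewrite rk.
apply: rkC => s.
have /eq_in_map/(_ s) tt_s := congr1 val tt.
apply: inord_inj (peirce_rank_lt _ _ _ _) (peirce_rank_lt _ _ _ _) (tt_s _).
by case: s {tt_s} => [[] []].
Qed.

End Classification.

Theorem theorem6p9 (p n r : nat) :
  prime p -> (0 < n)%N -> (0 < r)%N ->
  #|iso_classes (elem_ab p n r)| = ((r + 1) * (r + 2) * (r + 3)) %/ 6.
Proof.
move=> p_pr n_gt0 _.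
have [phi [psi [psiK phi_unit]]] := residue_Zp p_pr n_gt0.
rewrite /iso_classes.
rewrite (card_class_imset (ir_iso_peirce_type psiK phi_unit)).
rewrite peirce_type_imset // card_ord_partitions bin_ffactd !ffactnS ffactn0.
by rewrite addn1 addn2 addn3 muln1 /= mulnC (mulnC r.+2).
Qed.
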